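(* Let $\mathrm{k}$ be a commutative $\mathbb{Q}$-algebra, let $A$ be a $\mathrm{k}$-algebra, and let $\ell\in\mathbb{N}\cup\{\infty\}$. Then: (i) There is a $\mathrm{k}$-algebra morphism $\psi_\ell\colon(A^\ell,\cdot^1)\to A[x]/\binom{x}{\ell}$ defined by $\psi_\ell(a)=\sum_n a_n\binom{x}{n}$. (ii) There is a $\mathrm{k}$-algebra isomorphism $\phi_\ell\colon A[x]/\binom{x}{\ell}\to(A^\ell,\text{pointwise})$ defined by $\phi_\ell(f)_n=f(n)$ for $0\le n<\ell$. Moreover $\phi_\ell\circ\psi_\ell=\theta_\ell$, where $\theta_\ell\colon(A^\ell,\cdot^1)\to(A^\ell,\text{pointwise})$ is the $\mathrm{k}$-algebra isomorphism $\theta_\ell(a)_n=\sum_m\binom{n}{m}a_m$; consequently $\psi_\ell$ is invertible.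
   Context: Algebras are associative and unital, not necessarily commutative. For $\ell\in\mathbb{N}\cup\{\infty\}$, $A^\ell$ is the $\mathrm{k}$-module of sequences $(a_n)_{0\le n<\ell}$ in $A$ (so $A^\infty=A^{\mathbb{N}}$). The product $\cdot^1$ on $A^\ell$ is, for $0\le n<\ell$, $$(a\cdot^1 b)_n=\sum_{r+s+t=n}\binom{n}{r,s,t}a_{r+t}b_{s+t},\qquad \binom{n}{r,s,t}=\frac{n!}{r!\,s!\,t!},$$ with unit $(1,0,0,\dots)$. $(A^\ell,\text{pointwise})$ is $A^\ell$ with componentwise multiplication and unit $(1,1,1,\dots)$. $A[x]$ is the $\mathrm{k}$-algebra of polynomials in a (central) indeterminate $x$ with coefficients in $A$; $\binom{x}{0}=1$ and $\binom{x}{r}=\frac{x(x-1)\cdots(x-r+1)}{r!}$ for $r>0$. For $\ell\in\mathbb{N}$, $A[x]/\binom{x}{\ell}$ is the quotient of $A[x]$ by the ideal generated by $\binom{x}{\ell}$ (in it $\binom{x}{n}=0$ for all $n\ge\ell$). For $\ell=\infty$, $A[x]/\binom{x}{\infty}$ denotes the limit of the sequence of quotient maps $\cdots\to A[x]/\binom{x}{n}\to\cdots\to A[x]/\binom{x}{1}\to A[x]/\binom{x}{0}$; the infinite sum in (i) and the evaluation in (ii) are interpreted in this limit. *)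

(* Defs.v *)
From HB Require Import structures.
From mathcomp Require Import all_boot all_order all_algebra.
From mathcomp Require Import generic_quotient ring_quotient.
From mathcomp Require Import boolp functions zify.

Set Implicit Arguments.
Unset Strict Implicit.
Unset Printing Implicit Defensive.

Import GRing.Theory.
Local Open Scope ring_scope.
Local Open Scope quotient_scope.

Variant enat := Fin of nat | Infty.

Definition below (l : enat) (n : nat) : bool :=
  if l is Fin m then (n < m)%N else true.

Definition term_index (l : enat) : Type := {n : nat | below l n}.

(* algType requires 1 != 0, but A^0 and A[x]/binom(x,0) are zero rings. *)
Record pzAlgebra (k : pzRingType) := PzAlgebra {
  alg_ring :> pzRingType;
  ascale : k -> alg_ring -> alg_ring;
  ascaleA : forall a b u, ascale a (ascale b u) = ascale (a * b) u;
  ascale1 : forall u, ascale 1 u = u;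
  ascaleDr : forall a u v, ascale a (u + v) = ascale a u + ascale a v;
  ascaleDl : forall a b u, ascale (a + b) u = ascale a u + ascale b u;
  ascaleAl : forall a u v, ascale a (u * v) = ascale a u * v;
  ascaleAr : forall a u v, ascale a (u * v) = u * ascale a v
}.

Record algMorphism (k : pzRingType) (B C : pzAlgebra k) := AlgMorphism {
  alg_rmorphism :> {rmorphism B -> C};
  alg_morphismZ : forall a u,
    alg_rmorphism (ascale a u) = ascale a (alg_rmorphism u)
}.

(* The n-th term, made total by 0 for n >= l. *)
Definition nth_term (V : nmodType) l (a : term_index l -> V) (n : nat) : V :=
  if insub n is Some i then a i else 0.

Lemma termE (V : nmodType) l (a : term_index l -> V) (i : term_index l) :
  nth_term a (val i) = a i.
Proof. by rewrite /nth_term valK. Qed.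

Lemma below_le l m n : (m <= n)%N -> below l n -> below l m.
Proof. by case: l => //= p; exact: leq_ltn_trans. Qed.

Section Pointwise.
Context {k : comNzRingType}.
Variables (A : algType k) (l : enat).

Definition pointwise_seq : pzAlgebra k.
Proof.
refine (@PzAlgebra k (term_index l -> A : pzRingType) (fun c u => c *: u) _ _ _ _ _ _).
- by move=> a b u; exact: scalerA.
- by move=> u; exact: scale1r.
- by move=> a u v; exact: scalerDr.
- by move=> a b u; exact: scalerDl.
- by move=> a u v; apply/funext => i; exact: scalerAl.
- by move=> a u v; apply/funext => i; exact: scalerAr.
Defined.

End Pointwise.

Section CdotTerm.
Variable A : pzRingType.
Implicit Types (f g h : nat -> A).

Definition cdot_term f g (n : nat) : A :=
  \sum_(r < n.+1) \sum_(s < n.+1) \sum_(t < n.+1 | (r + s + t == n)%N)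
    (f (r + t)%N * g (s + t)%N) *+ (n`! %/ (r`! * s`! * t`!)).

Definition bin_transform f (n : nat) : A := \sum_(m < n.+1) f m *+ 'C(n, m).

Lemma eq_cdot_term f f' g g' n :
  (forall i, (i <= n)%N -> f i = f' i) -> (forall i, (i <= n)%N -> g i = g' i) ->
  cdot_term f g n = cdot_term f' g' n.
Proof.
move=> ff' gg'; apply: eq_bigr => r _; apply: eq_bigr => s _.
apply: eq_bigr => t /eqP rst; rewrite ff' ?gg' //; lia.
Qed.

Lemma bin_transform_inj f g n :
  (forall i, (i <= n)%N -> bin_transform f i = bin_transform g i) ->
  forall i, (i <= n)%N -> f i = g i.
Proof.
move=> fg; elim/ltn_ind => i IH le_in; have := fg i le_in.
rewrite /bin_transform !big_ord_recr /= binn !mulr1n.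
rewrite (eq_bigr (fun m : 'I_i => g m *+ 'C(i, m))) => [|m _]; first exact: addrI.
by rewrite IH // ltnW // (leq_trans (ltn_ord m)).
Qed.

Lemma multinomial_bin r s t :
  ((r + s + t)`! %/ (r`! * s`! * t`!) = 'C(r + s + t, r + t) * 'C(r + t, t))%N.
Proof.
have /bin_fact E1 : (r + t <= r + s + t)%N by lia.
have /bin_fact E2 : (t <= r + t)%N by lia.
rewrite (_ : r + s + t - (r + t) = s)%N in E1; last by lia.
rewrite addnK in E2; rewrite -E1 -E2.
set c := 'C(r + s + t, r + t); set d := 'C(r + t, t).
have -> : (c * (d * (t`! * r`!) * s`!) = c * d * (r`! * s`! * t`!))%N by nia.
by rewrite mulnK // !muln_gt0 !fact_gt0.
Qed.

Lemma bin_bin_shift n r s t : (r + s + t <= n)%N ->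
  ('C(n, r + s + t) * 'C(r + s + t, r + t) = 'C(n, r + t) * 'C(n - (r + t), s))%N.
Proof.
move=> rstn.
have /bin_fact E1 := rstn.
have /bin_fact E2 : (r + t <= r + s + t)%N by lia.
have /bin_fact E3 : (r + t <= n)%N by lia.
have /bin_fact E4 : (s <= n - (r + t))%N by lia.
rewrite (_ : r + s + t - (r + t) = s)%N in E2; last by lia.
rewrite (_ : n - (r + t) - s = n - (r + s + t))%N in E4; last by lia.
rewrite -E2 -E3 -E4 in E1.
have pos : (0 < s`! * (r + t)`! * (n - (r + s + t))`!)%N.
  by rewrite !muln_gt0 !fact_gt0.
by apply/eqP; rewrite -(eqn_pmul2r pos); apply/eqP; lia.
Qed.

Lemma big_ord_shift (F : nat -> A) N t :
  \sum_(i < N | (t <= i)%N) F i = \sum_(r < N | (r + t < N)%N) F (r + t)%N.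
Proof.
rewrite -(big_geq_mkord t N xpredT F) -{1}[t]add0n big_addn big_mkord.
by rewrite (big_ord_widen N (fun r => F (r + t)%N)) ?leq_subr //;
  apply: eq_bigl => r; lia.
Qed.

Lemma bin_transform_cdot f g n :
  bin_transform (cdot_term f g) n = bin_transform f n * bin_transform g n.
Proof.
pose F (r s t : nat) := (f (r + t)%N * g (s + t)%N)
  *+ ('C(n, r + t) * ('C(r + t, t) * 'C(n - (r + t), s))).
pose G (m r s t : nat) :=
  (f (r + t)%N * g (s + t)%N) *+ (m`! %/ (r`! * s`! * t`!)) *+ 'C(n, m).
have F0 r s t : (n < r + s + t)%N -> F r s t = 0.
  move=> nrst; rewrite /F; case: (ltnP n (r + t)) => [/bin_small->//|le].
  by rewrite (@bin_small (n - (r + t)) s) ?muln0 //; lia.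
transitivity (\sum_(t < n.+1) \sum_(r < n.+1) \sum_(s < n.+1) F r s t).
  transitivity (\sum_(m < n.+1) \sum_(r < n.+1) \sum_(s < n.+1)
       \sum_(t < n.+1 | (r + s + t == m)%N) G m r s t).
    apply: eq_bigr => m _; rewrite /cdot_term -sumrMnl.
    pose H1 (r : nat) := (\sum_(s < m.+1) \sum_(t < m.+1 | (r + s + t == m)%N)
      (f (r + t)%N * g (s + t)%N) *+ (m`! %/ (r`! * s`! * t`!))) *+ 'C(n, m).
    rewrite (big_ord_widen n.+1 H1) // big_mkcond /=; apply: eq_bigr => r _.
    case: ifP => rm; last first.
      by rewrite big1 // => s _; rewrite big1 // => t /eqP; lia.
    rewrite /H1 -sumrMnl.
    pose H2 (s : nat) := (\sum_(t < m.+1 | (r + s + t == m)%N)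
      (f (r + t)%N * g (s + t)%N) *+ (m`! %/ (r`! * s`! * t`!))) *+ 'C(n, m).
    rewrite (big_ord_widen n.+1 H2) // big_mkcond /=; apply: eq_bigr => s _.
    case: ifP => sm; last by rewrite big1 // => t /eqP; lia.
    rewrite /H2 -sumrMnl (big_ord_widen_cond n.+1 (fun t => (r + s + t == m)%N)
      (fun t => G m r s t)) //.
    by apply: eq_bigl => t; case: eqP => //=; lia.
  rewrite exchange_big [RHS]exchange_big /=; apply: eq_bigr => r _.
  rewrite exchange_big [RHS]exchange_big /=; apply: eq_bigr => s _.
  rewrite (exchange_big_dep xpredT) //=; apply: eq_bigr => t _.
  case: (ltnP n (r + s + t)) => rst.
    rewrite F0 // big1 // => m /eqP; have := ltn_ord m; lia.
  rewrite (big_pred1 (Ordinal (rst : (r + s + t < n.+1)%N))) /=; last first.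
    by move=> m; rewrite /= -val_eqE eq_sym.
  rewrite /G /F -mulrnA multinomial_bin; congr (_ *+ _).
  by have := bin_bin_shift rst; nia.
rewrite /bin_transform big_distrlr /=; symmetry.
pose H (i j t : nat) := (f i * g j) *+ ('C(n, i) * ('C(i, t) * 'C(n - i, j - t))).
transitivity (\sum_(i < n.+1) \sum_(j < n.+1)
    \sum_(t < n.+1 | (t <= j)%N) H i j t).
  apply: eq_bigr => i _; apply: eq_bigr => j _.
  rewrite mulrnAl mulrnAr -mulrnA mulnC.
  have -> : 'C(n, j) = 'C(i + (n - i), j) by rewrite subnKC // -ltnS.
  rewrite -binomial.Vandermonde big_distrr /= -sumrMnr.
  exact: (big_ord_widen n.+1 (fun t => H i j t)).
transitivity (\sum_(i < n.+1) \sum_(t < n.+1)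
    \sum_(j < n.+1 | (t <= j)%N) H i j t).
  by apply: eq_bigr => i _; rewrite (exchange_big_dep xpredT).
rewrite exchange_big /=; apply: eq_bigr => t _.
transitivity (\sum_(i < n.+1 | (t <= i)%N) \sum_(s < n.+1 | (s + t < n.+1)%N)
    H i (s + t)%N t).
  rewrite [RHS]big_mkcond /=; apply: eq_bigr => i _.
  have -> := big_ord_shift (fun j => H i j t) n.+1 t.
  case: leqP => // it; rewrite big1 // => s _.
  by rewrite /H (@bin_small i t) // mul0n muln0.
have -> := big_ord_shift (fun i => \sum_(s < n.+1 | (s + t < n.+1)%N)
    H i (s + t)%N t) n.+1 t.
rewrite big_mkcond /=.
apply: eq_bigr => r _; case: ifP => rt; last first.
  by rewrite big1 // => s _; rewrite F0 //; lia.
rewrite big_mkcond /=; apply: eq_bigr => s _; case: ifP => st.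
  by rewrite /H /F addnK.
by rewrite F0 //; lia.
Qed.
End CdotTerm.

Section CdotRing.
Variables (A : pzRingType) (l : enat).

Definition cdot_seqs : Type := term_index l -> A.
HB.instance Definition _ := GRing.Zmodule.copy cdot_seqs (term_index l -> A).
Implicit Types a b c : cdot_seqs.

Definition cdot_mul a b : cdot_seqs :=
  fun i => cdot_term (nth_term a) (nth_term b) (val i).
Definition cdot_one : cdot_seqs := fun i => (val i == 0%N)%:R.

Lemma term_below a n (ln : below l n) : nth_term a n = a (exist _ n ln).
Proof. exact: (termE a (exist _ n ln)). Qed.

Lemma term_cdot a b n : below l n ->
  nth_term (cdot_mul a b) n = cdot_term (nth_term a) (nth_term b) n.
Proof. by move=> ln; rewrite term_below. Qed.

Lemma termD a b n : nth_term (a + b) n = nth_term a n + nth_term b n.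
Proof. by rewrite /nth_term; case: insub => //; rewrite addr0. Qed.

Lemma eq_bin_transform f g n : (forall i, (i <= n)%N -> f i = g i) ->
  bin_transform f n = bin_transform g n :> A.
Proof. by move=> fg; apply: eq_bigr => m _; rewrite fg // -ltnS. Qed.

Lemma bin_transform_mul a b n : below l n ->
  bin_transform (nth_term (cdot_mul a b)) n =
  bin_transform (nth_term a) n * bin_transform (nth_term b) n.
Proof.
move=> ln; rewrite -bin_transform_cdot; apply: eq_bin_transform => i le_in.
by rewrite term_cdot // (below_le le_in).
Qed.

Lemma bin_transform_one n : below l n -> bin_transform (nth_term cdot_one) n = 1.
Proof.
move=> ln; rewrite /bin_transform big_ord_recl big1 => [|i _].
  by rewrite addr0 bin0 mulr1n (term_below _ (below_le (leq0n n) ln)).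
have li : below l (lift ord0 i) by apply: below_le ln; rewrite -ltnS.
by rewrite (term_below _ li) mul0rn.
Qed.

Lemma bin_transformD a b n : bin_transform (nth_term (a + b)) n =
  bin_transform (nth_term a) n + bin_transform (nth_term b) n.
Proof. by rewrite -big_split; apply: eq_bigr => m _; rewrite termD mulrnDl. Qed.

Lemma cdot_eq a b : (forall n, below l n ->
  bin_transform (nth_term a) n = bin_transform (nth_term b) n) -> a = b.
Proof.
move=> ab; apply/funext => i; rewrite -[a i]termE -[b i]termE.
apply: (@bin_transform_inj _ (nth_term a) (nth_term b) (val i)) => // j ji.
by apply: ab; exact: below_le ji (valP i).
Qed.

Lemma cdot_mulA : associative cdot_mul.
Proof. by move=> a b c; apply: cdot_eq => n ln; rewrite !bin_transform_mul ?mulrA. Qed.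
Lemma cdot_mul1l : left_id cdot_one cdot_mul.
Proof.
by move=> a; apply: cdot_eq => n ln; rewrite bin_transform_mul ?bin_transform_one ?mul1r.
Qed.
Lemma cdot_mul1r : right_id cdot_one cdot_mul.
Proof.
by move=> a; apply: cdot_eq => n ln; rewrite bin_transform_mul ?bin_transform_one ?mulr1.
Qed.
Lemma cdot_mulDl : left_distributive cdot_mul +%R.
Proof.
move=> a b c; apply: cdot_eq => n ln.
by rewrite bin_transformD !bin_transform_mul // bin_transformD mulrDl.
Qed.
Lemma cdot_mulDr : right_distributive cdot_mul +%R.
Proof.
move=> a b c; apply: cdot_eq => n ln.
by rewrite bin_transformD !bin_transform_mul // bin_transformD mulrDr.
Qed.

HB.instance Definition _ := GRing.Zmodule_isPzRing.Build cdot_seqs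
  cdot_mulA cdot_mul1l cdot_mul1r cdot_mulDl cdot_mulDr.

End CdotRing.

Section CdotAlgebra.
Context {k : comNzRingType}.
Variables (A : algType k) (l : enat).

Definition cdot_scale (c : k) (u : cdot_seqs A l) : cdot_seqs A l :=
  fun i => c *: u i.

Lemma term_scale c (u : cdot_seqs A l) n :
  nth_term (cdot_scale c u) n = c *: nth_term u n.
Proof. by rewrite /nth_term; case: insub => //; rewrite scaler0. Qed.

Definition cdot_seq : pzAlgebra k.
Proof.
refine (@PzAlgebra k (cdot_seqs A l) cdot_scale _ _ _ _ _ _).
- by move=> a b u; apply/funext => i; exact: scalerA.
- by move=> u; apply/funext => i; exact: scale1r.
- by move=> a u v; apply/funext => i; exact: scalerDr.
- by move=> a b u; apply/funext => i; exact: scalerDl.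
- move=> a u v; apply/funext => i; rewrite /cdot_scale /GRing.mul /=.
  rewrite scaler_sumr; apply: eq_bigr => r _; rewrite scaler_sumr.
  apply: eq_bigr => s _; rewrite scaler_sumr; apply: eq_bigr => t _.
  by rewrite term_scale -scalerMnr scalerAl.
- move=> a u v; apply/funext => i; rewrite /cdot_scale /GRing.mul /=.
  rewrite scaler_sumr; apply: eq_bigr => r _; rewrite scaler_sumr.
  apply: eq_bigr => s _; rewrite scaler_sumr; apply: eq_bigr => t _.
  by rewrite term_scale -scalerMnr scalerAr.
Defined.

End CdotAlgebra.

Section IdealQuotient.
Variables (R : pzRingType) (g : R).

Definition ideal_gen : {pred R} := fun p =>
  `[< exists s : seq (R * R), p = \sum_(uv <- s) uv.1 * g * uv.2 >].

Lemma ideal_genP p : reflect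
  (exists s : seq (R * R), p = \sum_(uv <- s) uv.1 * g * uv.2)
  (p \in ideal_gen).
Proof. exact: asboolP. Qed.

Lemma ideal_gen_zmod_closed : zmod_closed ideal_gen.
Proof.
split=> [|p q /ideal_genP[s ->] /ideal_genP[t ->]].
  by apply/ideal_genP; exists [::]; rewrite big_nil.
apply/ideal_genP; exists (s ++ [seq (- uv.1, uv.2) | uv <- t]).
rewrite big_cat big_map -sumrN; congr (_ + _).
by apply: eq_bigr => uv _; rewrite !mulNr.
Qed.

HB.instance Definition _ :=
  GRing.isZmodClosed.Build R ideal_gen ideal_gen_zmod_closed.

Lemma ideal_genMl u p : p \in ideal_gen -> u * p \in ideal_gen.
Proof.
case/ideal_genP => s ->; apply/ideal_genP.
exists [seq (u * vw.1, vw.2) | vw <- s]; rewrite big_map mulr_sumr.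
by apply: eq_bigr => vw _; rewrite !mulrA.
Qed.

Lemma ideal_genMr u p : p \in ideal_gen -> p * u \in ideal_gen.
Proof.
case/ideal_genP => s ->; apply/ideal_genP.
exists [seq (vw.1, vw.2 * u) | vw <- s]; rewrite big_map mulr_suml.
by apply: eq_bigr => vw _; rewrite !mulrA.
Qed.

Lemma ideal_gen_id : g \in ideal_gen.
Proof. by apply/ideal_genP; exists [:: (1, 1)]; rewrite big_seq1 mul1r mulr1. Qed.

Definition ideal_quot : Type := (Quotient.quot ideal_gen).
HB.instance Definition _ := GRing.Zmodule.on ideal_quot.

Definition quot_class (p : R) : ideal_quot := \pi_(Quotient.quot ideal_gen) p.

Lemma quot_classP p q : quot_class p = quot_class q <-> p - q \in ideal_gen.
Proof. by rewrite Quotient.idealrBE; split=> /eqP. Qed.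

Lemma quot_class_repr (x : ideal_quot) : quot_class (repr x) = x.
Proof. exact: reprK. Qed.

Lemma quot_classD p q : quot_class (p + q) = quot_class p + quot_class q.
Proof. exact: (raddfD \pi_(Quotient.quot ideal_gen)). Qed.

Definition quot_mul (x y : ideal_quot) : ideal_quot :=
  quot_class (repr x * repr y).

Lemma quot_classM p q :
  quot_class (p * q) = quot_mul (quot_class p) (quot_class q).
Proof.
have ep := quot_class_repr (quot_class p); have eq := quot_class_repr (quot_class q).
apply/quot_classP; set p' := repr (quot_class p); set q' := repr (quot_class q).
rewrite -(subrKA (p' * q)) -mulrBl -mulrBr rpredD //.
  by rewrite ideal_genMr //; apply/quot_classP.
by rewrite ideal_genMl //; apply/quot_classP.
Qed.

Lemma quot_mulA : associative quot_mul.
Proof.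
move=> x y z; rewrite -[x]quot_class_repr -[y]quot_class_repr -[z]quot_class_repr.
by rewrite -!quot_classM mulrA.
Qed.
Lemma quot_mul1l : left_id (quot_class 1) quot_mul.
Proof. by move=> x; rewrite -[x]quot_class_repr -quot_classM mul1r. Qed.
Lemma quot_mul1r : right_id (quot_class 1) quot_mul.
Proof. by move=> x; rewrite -[x]quot_class_repr -quot_classM mulr1. Qed.
Lemma quot_mulDl : left_distributive quot_mul +%R.
Proof.
move=> x y z; rewrite -[x]quot_class_repr -[y]quot_class_repr -[z]quot_class_repr.
by rewrite -quot_classD -!quot_classM -quot_classD mulrDl.
Qed.
Lemma quot_mulDr : right_distributive quot_mul +%R.
Proof.
move=> x y z; rewrite -[x]quot_class_repr -[y]quot_class_repr -[z]quot_class_repr.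
by rewrite -quot_classD -!quot_classM -quot_classD mulrDr.
Qed.

HB.instance Definition _ := GRing.Zmodule_isPzRing.Build ideal_quot
  quot_mulA quot_mul1l quot_mul1r quot_mulDl quot_mulDr.

End IdealQuotient.

Section PolynomialQuotients.
Context {k : comAlgType rat}.
Variable A : algType k.

Definition rat_const (q : rat) : A := (q%:A : k)%:A.

Definition binomial_poly (n : nat) : {poly A} :=
  rat_const n`!%:R^-1 *: \prod_(i < n) ('X - i%:R).

Definition poly_quot_ring (n : nat) : pzRingType := ideal_quot (binomial_poly n).

Definition poly_class (n : nat) (p : {poly A}) : poly_quot_ring n := quot_class _ p.

Lemma rat_constM p q : rat_const (p * q) = rat_const p * rat_const q.
Proof. by rewrite /rat_const -!in_algE !rmorphM. Qed.

Lemma rat_const_comm q (a : A) : rat_const q * a = a * rat_const q.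
Proof. by rewrite /rat_const -scalerAl -scalerAr mul1r mulr1. Qed.

Lemma binomial_polyS n :
  binomial_poly n.+1 \in ideal_gen (binomial_poly n).
Proof.
pose c : {poly A} := rat_const n.+1%:R^-1 *: ('X - n%:R).
suff -> : binomial_poly n.+1 = binomial_poly n * c.
  exact/ideal_genMr/ideal_gen_id.
rewrite /binomial_poly /c big_ord_recr /= factS natrM invfM rat_constM.
rewrite rat_const_comm -!mul_polyC polyCM !mulrA; congr (_ * _).
rewrite -!mulrA; congr (_ * _); apply/polyP => i.
by rewrite coefCM coefMC rat_const_comm.
Qed.

Lemma ideal_gen_binomialS n p :
  p \in ideal_gen (binomial_poly n.+1) -> p \in ideal_gen (binomial_poly n).
Proof.
case/ideal_genP => s ->; apply: rpred_sum => uv _.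
by apply/ideal_genMr/ideal_genMl/binomial_polyS.
Qed.

Definition poly_quot_scale n (c : k) (u : poly_quot_ring n) : poly_quot_ring n :=
  poly_class n (c%:A *: repr u).

Lemma poly_class_scale n (c : k) (p : {poly A}) :
  poly_class n (c%:A *: p) = poly_quot_scale c (poly_class n p).
Proof.
apply/quot_classP; rewrite -scalerBr -mul_polyC; apply: ideal_genMl.
by apply/quot_classP; rewrite quot_class_repr.
Qed.

Lemma poly_classK n (u : poly_quot_ring n) : poly_class n (repr u) = u.
Proof. exact: quot_class_repr. Qed.

Lemma poly_classD n p q : poly_class n (p + q) = poly_class n p + poly_class n q.
Proof. exact: quot_classD. Qed.

Lemma poly_classM n p q : poly_class n (p * q) = poly_class n p * poly_class n q.
Proof. exact: quot_classM. Qed.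

Definition poly_quot (n : nat) : pzAlgebra k.
Proof.
refine (@PzAlgebra k (poly_quot_ring n) (@poly_quot_scale n) _ _ _ _ _ _).
- move=> a b u; rewrite -[u]poly_classK -!poly_class_scale.
  by rewrite scalerA -scalerAl mul1r scalerA.
- by move=> u; rewrite -[u]poly_classK -!poly_class_scale !scale1r.
- move=> a u v; rewrite -[u]poly_classK -[v]poly_classK.
  by rewrite -poly_classD -!poly_class_scale scalerDr poly_classD.
- move=> a b u; rewrite -[u]poly_classK -!poly_class_scale.
  by rewrite -poly_classD -scalerDl -scalerDl.
- move=> a u v; rewrite -[u]poly_classK -[v]poly_classK.
  by rewrite -poly_classM -!poly_class_scale -poly_classM scalerAl.
- move=> a u v; rewrite -[u]poly_classK -[v]poly_classK.
  rewrite -poly_classM -!poly_class_scale -poly_classM; congr poly_class.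
  rewrite -!mul_polyC !mulrA; congr (_ * _); apply/polyP => i.
  by rewrite coefCM coefMC -scalerAl mul1r -scalerAr mulr1.
Defined.

Definition poly_trans n (u : poly_quot n.+1) : poly_quot n :=
  poly_class n (repr u).

Lemma poly_trans_class n p : poly_trans (poly_class n.+1 p) = poly_class n p.
Proof.
apply/quot_classP/ideal_gen_binomialS/quot_classP.
by rewrite quot_class_repr.
Qed.

Record poly_lim := PolyLim {
  lim_proj :> forall n, poly_quot n;
  lim_coherent : forall n, poly_trans (lim_proj n.+1) = lim_proj n
}.

HB.instance Definition _ := gen_eqMixin poly_lim.
HB.instance Definition _ := gen_choiceMixin poly_lim.

Lemma poly_limP (u v : poly_lim) : (forall n, u n = v n) -> u = v.
Proof.
case: u v => [u uP] [v vP] /= uv.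
have {}uv : u = v by apply: functional_extensionality_dep.
by rewrite -uv in vP *; congr PolyLim; exact: Prop_irrelevance.
Qed.

Lemma poly_transD n (u v : poly_quot n.+1) :
  poly_trans (u + v) = poly_trans u + poly_trans v.
Proof.
rewrite -[u]poly_classK -[v]poly_classK -poly_classD !poly_trans_class.
exact: poly_classD.
Qed.

Lemma poly_transM n (u v : poly_quot n.+1) :
  poly_trans (u * v) = poly_trans u * poly_trans v.
Proof.
rewrite -[u]poly_classK -[v]poly_classK -poly_classM !poly_trans_class.
exact: poly_classM.
Qed.

Lemma poly_transZ n c (u : poly_quot n.+1) :
  poly_trans (ascale c u) = ascale c (poly_trans u).
Proof.
rewrite -[u]poly_classK -[LHS]/(poly_trans (poly_quot_scale c _)).
by rewrite -poly_class_scale !poly_trans_class poly_class_scale.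
Qed.

Lemma poly_trans1 n : poly_trans (1 : poly_quot n.+1) = 1.
Proof. exact: poly_trans_class. Qed.

Lemma poly_trans0 n : poly_trans (0 : poly_quot n.+1) = 0.
Proof. by apply: (addrI (poly_trans 0)); rewrite -poly_transD !addr0. Qed.

Lemma poly_transN n (u : poly_quot n.+1) : poly_trans (- u) = - poly_trans u.
Proof. by apply/eqP; rewrite -addr_eq0 -poly_transD addNr poly_trans0. Qed.

Definition lim_zero : poly_lim := PolyLim (fun n => poly_trans0 n).
Definition lim_one : poly_lim := PolyLim (fun n => poly_trans1 n).

Definition lim_opp (u : poly_lim) : poly_lim.
Proof.
refine (@PolyLim (fun n => - u n) _).
by move=> n; rewrite poly_transN lim_coherent.
Defined.

Definition lim_add (u v : poly_lim) : poly_lim.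
Proof.
refine (@PolyLim (fun n => u n + v n) _).
by move=> n; rewrite poly_transD !lim_coherent.
Defined.

Definition lim_mul (u v : poly_lim) : poly_lim.
Proof.
refine (@PolyLim (fun n => u n * v n) _).
by move=> n; rewrite poly_transM !lim_coherent.
Defined.

Definition lim_scale (c : k) (u : poly_lim) : poly_lim.
Proof.
refine (@PolyLim (fun n => ascale c (u n)) _).
by move=> n; rewrite poly_transZ lim_coherent.
Defined.

Lemma lim_addA : associative lim_add.
Proof. by move=> u v w; apply: poly_limP => n; exact: addrA. Qed.
Lemma lim_addC : commutative lim_add.
Proof. by move=> u v; apply: poly_limP => n; exact: addrC. Qed.
Lemma lim_add0 : left_id lim_zero lim_add.
Proof. by move=> u; apply: poly_limP => n; exact: add0r. Qed.
Lemma lim_addN : left_inverse lim_zero lim_opp lim_add.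
Proof. by move=> u; apply: poly_limP => n; exact: addNr. Qed.
Lemma lim_mulA : associative lim_mul.
Proof. by move=> u v w; apply: poly_limP => n; exact: mulrA. Qed.
Lemma lim_mul1l : left_id lim_one lim_mul.
Proof. by move=> u; apply: poly_limP => n; exact: mul1r. Qed.
Lemma lim_mul1r : right_id lim_one lim_mul.
Proof. by move=> u; apply: poly_limP => n; exact: mulr1. Qed.
Lemma lim_mulDl : left_distributive lim_mul lim_add.
Proof. by move=> u v w; apply: poly_limP => n; exact: mulrDl. Qed.
Lemma lim_mulDr : right_distributive lim_mul lim_add.
Proof. by move=> u v w; apply: poly_limP => n; exact: mulrDr. Qed.

HB.instance Definition _ := GRing.isZmodule.Build poly_lim
  lim_addA lim_addC lim_add0 lim_addN.
HB.instance Definition _ := GRing.Zmodule_isPzRing.Build poly_lim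
  lim_mulA lim_mul1l lim_mul1r lim_mulDl lim_mulDr.

Definition poly_lim_alg : pzAlgebra k.
Proof.
refine (@PzAlgebra k (poly_lim : pzRingType) lim_scale _ _ _ _ _ _).
- by move=> a b u; apply: poly_limP => n; exact: ascaleA.
- by move=> u; apply: poly_limP => n; exact: ascale1.
- by move=> a u v; apply: poly_limP => n; exact: ascaleDr.
- by move=> a b u; apply: poly_limP => n; exact: ascaleDl.
- by move=> a u v; apply: poly_limP => n; exact: ascaleAl.
- by move=> a u v; apply: poly_limP => n; exact: ascaleAr.
Defined.

Definition poly_mod_binomial (l : enat) : pzAlgebra k :=
  match l with Fin m => poly_quot m | Infty => poly_lim_alg end.

(* u = \sum_n a_n binom(x,n) in A[x]/binom(x,l).  For l = oo the series
   converges to u in the inverse limit of the discrete A[x]/binom(x,N). *)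
Definition is_binomial_series l :
    (term_index l -> A) -> poly_mod_binomial l -> Prop :=
  match l return (term_index l -> A) -> poly_mod_binomial l -> Prop with
  | Fin m => fun a u =>
      u = poly_class m (\sum_(n < m) nth_term a n *: binomial_poly n)
  | Infty => fun a u => forall N, exists M0, forall M, (M0 <= M)%N ->
      u N = poly_class N (\sum_(n < M) nth_term a n *: binomial_poly n)
  end.

(* v = u(n) for u in A[x]/binom(x,l) and n < l, computed from any polynomial
   representing u, resp. any component of u in which evaluation at n makes
   sense. *)
Definition is_value_at l : poly_mod_binomial l -> nat -> A -> Prop :=
  match l return poly_mod_binomial l -> nat -> A -> Prop with
  | Fin m => fun u n v => forall p, u = poly_class m p -> v = p.[n%:R]
  | Infty => fun u n v => forall N p, (n < N)%N ->
      u N = poly_class N p -> v = p.[n%:R]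
  end.

End PolynomialQuotients.

(* Main.v *)
(* Evaluating sum_n a_n binom(x,n) at m gives sum_n binom(m,n) a_n, and the
   binomial transform a |-> sum_n binom(m,n) a_n is multiplicative from cdot^1
   to the pointwise product and bijective by triangularity.  Evaluation at
   0, ..., N-1 has kernel exactly the ideal generated by binom(x,N): the n are
   central and the factor theorem applies successively, the values n! being
   invertible over Q.  So phi is injective, and psi is an algebra morphism
   because phi o psi = theta is one; bijectivity of phi and psi follows from
   surjectivity of theta. *)
Require Import Defs.
From mathcomp Require Import all_boot all_algebra.
From HB Require Import structures.
From mathcomp Require Import boolp zify.

Import GRing.Theory.
Local Open Scope ring_scope.

Set Implicit Arguments.
Unset Strict Implicit.
Unset Printing Implicit Defensive.

(** * Bijections and algebra morphisms from bare functions *)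

Lemma inj_surj_bij (T U : Type) (f : T -> U) :
  injective f -> (forall y, exists x, f x = y) -> bijective f.
Proof.
move=> f_inj /choice[g gP]; exists g => [x|y]; last exact: gP.
by apply: f_inj; rewrite gP.
Qed.

Lemma algMorphism_intro (k : pzRingType) (B C : pzAlgebra k) (f : B -> C) :
    {morph f : u v / u + v} -> f 1 = 1 -> {morph f : u v / u * v} ->
    (forall c u, f (ascale c u) = ascale c (f u)) ->
  exists g : algMorphism B C, forall u, g u = f u.
Proof.
move=> fD f1 fM fZ.
have fN : zmod_morphism f.
  have f0 : f 0 = 0 by apply: (addrI (f 0)); rewrite -fD !addr0.
  by move=> u v; rewrite fD; congr (_ + _); apply/eqP; rewrite -addr_eq0 -fD addNr f0.
pose fA := GRing.isZmodMorphism.Build B C f fN.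
pose fMM := GRing.isMonoidMorphism.Build B C f (conj f1 fM).
pose g : {rmorphism B -> C} := HB.pack f fA fMM.
by exists (@AlgMorphism k B C g fZ).
Qed.

(** * Surjectivity of the binomial transform *)

Section BinTransform.
Variable A : pzRingType.

(** The transform is triangular with diagonal entries 1, so finitely many equations can be solved
    one after another. Solutions for different [N] agree where both are valid, by injectivity on
    initial segments, and glue. *)
Lemma bin_transform_surj (f : nat -> A) :
  exists g, forall n, bin_transform g n = f n.
Proof.
have /choice[g gP] (N : nat) :
    exists g, forall n, (n < N)%N -> bin_transform g n = f n.
  elim: N => [|N [g gP]]; first by exists (fun=> 0).
  (* Since 'C(N, N) = 1, the N-th equation forces the value at [N]; values beyond [N] are
     irrelevant. *)
  pose h n := if (n < N)%N then g n else f N - \sum_(m < N) g m *+ 'C(N, m).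
  exists h => n; rewrite ltnS leq_eqVlt => /predU1P[->|ltnN].
    rewrite /bin_transform big_ord_recr /= {2}/h ltnn binn mulr1n.
    rewrite (eq_bigr (fun m : 'I_N => g m *+ 'C(N, m))); first by rewrite addrC subrK.
    by move=> m _; rewrite /h ltn_ord.
  rewrite -gP //; apply: eq_bin_transform => i le_in.
  by rewrite /h (leq_ltn_trans le_in).
exists (fun n => g n.+1 n) => n; rewrite -(gP n.+1) //.
apply: eq_bin_transform => i le_in.
apply: (@bin_transform_inj A _ _ i) => // j le_ji.
by rewrite !gP //; lia.
Qed.

End BinTransform.

(** * Evaluation of polynomials at natural numbers *)

Section NatEvaluation.
Context {k : comAlgType rat}.
Variable A : algType k.
Implicit Types (p q : {poly A}) (a : nat -> A).

Lemma rat_const_nat n : rat_const A n%:R = n%:R.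
Proof. by rewrite /rat_const -!in_algE !rmorph_nat. Qed.

Lemma rat_const_natK n (x : A) : (0 < n)%N ->
  rat_const A n%:R^-1 * (x *+ n) = x.
Proof.
move=> n_gt0; rewrite -[x *+ n]mulr_natl -rat_const_nat mulrA -rat_constM.
rewrite mulVf; first by rewrite (rat_const_nat 1) mul1r.
by rewrite Num.Theory.pnatr_eq0 -lt0n.
Qed.

(** Although [A] need not be commutative, natural numbers are central in it. *)
Lemma hornerM_nat p q n : (p * q).[n%:R] = p.[n%:R] * q.[n%:R].
Proof. by rewrite hornerM_comm // /comm_poly (commr_nat q.[n%:R]). Qed.

Lemma horner_falling_nat N m :
  (\prod_(i < N) ('X - i%:R : {poly A})).[m%:R] = (m ^_ N)%:R.
Proof.
elim: N => [|N IH]; first by rewrite big_ord0 hornerC.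
rewrite big_ord_recr /= hornerM_nat IH ffactnSr natrM.
(* Truncated and ring subtraction of [N] from [m] differ only for m < N, where the falling factorial
   is already 0. *)
rewrite -polyC_natr hornerXsubC; case: (leqP N m) => [/natrB->//|lt_mN].
by rewrite ffact_small // !mul0r.
Qed.

Lemma horner_binomial_nat N m : (binomial_poly A N).[m%:R] = 'C(m, N)%:R.
Proof.
rewrite /binomial_poly hornerZ horner_falling_nat -bin_ffact natrM mulr_natr.
by rewrite rat_const_natK ?fact_gt0.
Qed.

(** Terms of index above [m] vanish at [m], so all long enough partial sums have the same value
    there. *)
Lemma horner_binomial_sum a N M m : (m < N)%N -> (N <= M)%N ->
  (\sum_(n < M) a n *: binomial_poly A n).[m%:R] = bin_transform a m.
Proof.
move=> lt_mN le_NM; rewrite horner_sum /bin_transform.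
rewrite (big_ord_widen M (fun n => a n *+ 'C(m, n))); last by lia.
rewrite [RHS]big_mkcond; apply: eq_bigr => n _ /=.
rewrite hornerZ horner_binomial_nat mulr_natr; case: ltnP => // lt_mn.
by rewrite bin_small.
Qed.

Lemma ideal_binomial_horner N p n : (n < N)%N ->
  p \in ideal_gen (binomial_poly A N) -> p.[n%:R] = 0.
Proof.
move=> lt_nN /ideal_genP[s ->]; rewrite horner_sum big1 // => uv _.
by rewrite !hornerM_nat horner_binomial_nat bin_small // mulr0 mul0r.
Qed.

Lemma horner_ideal_binomial N p : (forall n, (n < N)%N -> p.[n%:R] = 0) ->
  p \in ideal_gen (binomial_poly A N).
Proof.
move=> p0.
have [q ->] : exists q, p = q * \prod_(i < N) ('X - i%:R : {poly A}).
  elim: N p0 => [|N IH] p0; first by exists p; rewrite big_ord0 mulr1.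
  have {}/IH[q pq] n : (n < N)%N -> p.[n%:R] = 0 by move=> ltnN; apply: p0; lia.
  (* At [N] the product of the earlier factors is N!, which is invertible, so p(N) = 0 gives q(N) =
     0. *)
  have /factor_theorem[r qr] : root q N%:R.
    have := p0 N (ltnSn N).
    rewrite pq hornerM_nat horner_falling_nat ffactnn mulr_natr.
    move/(congr1 ( *%R (rat_const A N`!%:R^-1))).
    by rewrite rat_const_natK ?fact_gt0 // mulr0 => /eqP.
  exists r; rewrite pq qr big_ord_recr /= -mulrA polyC_natr; congr (_ * _).
  (* The new factor comes out to the left of the product; it moves to the right because all the X -
     i commute. *)
  apply: commr_prod => i _; apply: commrB; last exact: commr_nat.
  by apply/commr_sym/commrB; [exact: erefl | exact: commr_nat].
suff -> : \prod_(i < N) ('X - i%:R) = (N`!%:R : {poly A}) * binomial_poly A N.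
  by rewrite ideal_genMl ?ideal_genMl ?ideal_gen_id.
rewrite /binomial_poly -mul_polyC mulrA -polyC_natr -polyCM.
by rewrite -rat_const_comm rat_const_natK ?fact_gt0 // mul1r.
Qed.

Lemma poly_class_eq N p q : poly_class N p = poly_class N q <->
  (forall n, (n < N)%N -> p.[n%:R] = q.[n%:R]).
Proof.
split=> [/quot_classP pq n lt_nN|pq].
  by apply/eqP; rewrite -subr_eq0 -hornerN -hornerD (ideal_binomial_horner lt_nN).
apply/quot_classP/horner_ideal_binomial => n lt_nN.
by rewrite hornerD hornerN pq // subrr.
Qed.

(** Independent of the chosen representative only for n < N. *)
Definition quot_value N (u : poly_quot A N) (n : nat) : A := (repr u).[n%:R].

Section QuotValue.
Variables (N n : nat).
Hypothesis lt_nN : (n < N)%N.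
Implicit Types u v : poly_quot A N.

Lemma quot_value_class p : quot_value (poly_class N p) n = p.[n%:R].
Proof. by have /poly_class_eq/(_ n lt_nN) := poly_classK (poly_class N p). Qed.

Lemma quot_valueD u v : quot_value (u + v) n = quot_value u n + quot_value v n.
Proof.
rewrite -[u]poly_classK -[v]poly_classK -poly_classD !quot_value_class.
exact: hornerD.
Qed.

Lemma quot_value1 : quot_value (1 : poly_quot A N) n = 1.
Proof. by rewrite (quot_value_class 1) hornerC. Qed.

Lemma quot_valueM u v : quot_value (u * v) n = quot_value u n * quot_value v n.
Proof.
rewrite -[u]poly_classK -[v]poly_classK -poly_classM !quot_value_class.
exact: hornerM_nat.
Qed.

Lemma quot_valueZ c u : quot_value (ascale c u) n = c *: quot_value u n.
Proof.
rewrite -[u]poly_classK -[ascale c _]/(poly_quot_scale c _) -poly_class_scale.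
by rewrite !quot_value_class hornerZ -scalerAl mul1r.
Qed.

End QuotValue.

Lemma quot_value_inj N (u v : poly_quot A N) :
  (forall n, (n < N)%N -> quot_value u n = quot_value v n) -> u = v.
Proof.
move=> uv; rewrite -[u]poly_classK -[v]poly_classK.
by apply/poly_class_eq => n; exact: uv.
Qed.

Lemma quot_value_trans N (u : poly_quot A N.+1) n : (n < N)%N ->
  quot_value (poly_trans u) n = quot_value u n.
Proof. by move=> lt_nN; rewrite quot_value_class. Qed.

Lemma lim_value (u : poly_lim A) N n : (n < N)%N ->
  quot_value (u N) n = quot_value (u n.+1) n.
Proof.
elim: N => // N IH; rewrite ltnS leq_eqVlt => /predU1P[->//|lt_nN].
by rewrite -IH // -(lim_coherent u N) quot_value_trans.
Qed.

Variable l : enat.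

(** In the limit, component n + 1 is the first on which evaluation at [n] is well defined. *)
Definition value : poly_mod_binomial A l -> nat -> A :=
  match l return poly_mod_binomial A l -> nat -> A with
  | Fin m => fun u n => quot_value u n
  | Infty => fun u n => quot_value (u n.+1) n
  end.

End NatEvaluation.

(** * Values and binomial series, for finite and infinite [l] alike *)

Section Value.
Context {k : comAlgType rat}.
Variables (A : algType k) (l : enat).
Implicit Types u v : poly_mod_binomial A l.

Lemma is_value_at_value u n : below l n -> is_value_at u n (value u n).
Proof.
case: l u => [m|] u ltn; first by move=> p ->; exact: quot_value_class.
by move=> N p lt_nN uN; rewrite /value -(lim_value u lt_nN) uN quot_value_class.
Qed.

Lemma valueD u v n : below l n -> value (u + v) n = value u n + value v n.
Proof. by case: l u v => [m|] u v ltn; exact: quot_valueD. Qed.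

Lemma value1 n : below l n -> value (1 : poly_mod_binomial A l) n = 1.
Proof. by case: l => [m|] ltn; exact: quot_value1. Qed.

Lemma valueM u v n : below l n -> value (u * v) n = value u n * value v n.
Proof. by case: l u v => [m|] u v ltn; exact: quot_valueM. Qed.

Lemma valueZ c u n : below l n -> value (ascale c u) n = c *: value u n.
Proof. by case: l u => [m|] u ltn; exact: quot_valueZ. Qed.

Lemma value_inj u v : (forall n, below l n -> value u n = value v n) -> u = v.
Proof.
case: l u v => [m|] u v uv; first exact: quot_value_inj.
apply: poly_limP => N; apply: quot_value_inj => n lt_nN.
by rewrite !lim_value //; exact: uv.
Qed.

Lemma binomial_series_exists (a : term_index l -> A) :
  exists u, is_binomial_series a u.
Proof.
case: l a => [m|] a; first by eexists.
(* Modulo binom(x,N) all terms of index at least [N] vanish, so these truncations form a coherent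
   family. *)
pose s N := poly_class N (\sum_(n < N) nth_term a n *: binomial_poly A n).
have sE N M : (N <= M)%N ->
    s N = poly_class N (\sum_(n < M) nth_term a n *: binomial_poly A n).
  move=> le_NM; apply/poly_class_eq => n lt_nN.
  by rewrite !(horner_binomial_sum _ lt_nN).
have sP N : poly_trans (s N.+1) = s N by rewrite poly_trans_class -sE.
by exists (PolyLim sP) => N; exists N => M; exact: sE.
Qed.

Lemma binomial_series_value (a : term_index l -> A) u n : below l n ->
  is_binomial_series a u -> value u n = bin_transform (nth_term a) n.
Proof.
(* The maximum makes the partial sum long enough both to represent component n + 1 and to have its
   final value at [n]. *)
case: l a u => [m|] a u ltn => [->|/(_ n.+1)[M0 /(_ (maxn M0 n.+1))]].
  by rewrite /value quot_value_class // (@horner_binomial_sum _ _ _ m).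
rewrite /value leq_maxl => ->//; rewrite quot_value_class //.
by rewrite (@horner_binomial_sum _ _ _ n.+1) ?leq_maxr.
Qed.

End Value.

Lemma nth_term_bin_surj (A : pzRingType) (l : enat) (v : term_index l -> A) :
  exists a : term_index l -> A,
    forall n : term_index l, bin_transform (nth_term a) (val n) = v n.
Proof.
have [g gP] := bin_transform_surj (nth_term v).
(* Restricting to indices below [l] is harmless: the transform at [n] only reads terms of index at
   most [n]. *)
exists (g \o val) => n; rewrite -(termE v) -gP; apply: eq_bin_transform => i le_in.
by rewrite (term_below _ (below_le le_in (valP n))).
Qed.

(** * Construction and bijectivity of the three morphisms *)

Theorem proposition3p2 (k : comAlgType rat) (A : algType k) (l : enat) :
  exists psi : algMorphism (cdot_seq A l) (poly_mod_binomial A l),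
    (forall a : term_index l -> A, is_binomial_series a (psi a)) /\
  exists phi : algMorphism (poly_mod_binomial A l) (pointwise_seq A l),
    (forall (f : poly_mod_binomial A l) (n : term_index l),
       is_value_at f (val n) ((phi f : term_index l -> A) n)) /\
    bijective phi /\
  exists theta : algMorphism (cdot_seq A l) (pointwise_seq A l),
    (forall (a : term_index l -> A) (n : term_index l),
       (theta a : term_index l -> A) n =
       \sum_(m < (val n).+1) nth_term a m *+ 'C(val n, m)) /\
    bijective theta /\
    (forall a : cdot_seq A l, phi (psi a) = theta a) /\
    bijective psi.
Proof.
have [phi phiE] : exists phi : algMorphism (poly_mod_binomial A l) (pointwise_seq A l),
    forall u, phi u = (fun n => value u (val n)).
  apply: algMorphism_intro => [u v||u v|c u]; apply/funext => n.
  - exact: valueD (valP n).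
  - exact: value1 (valP n).
  - exact: valueM (valP n).
  - exact: valueZ (valP n).
have [theta thetaE] : exists theta : algMorphism (cdot_seq A l) (pointwise_seq A l),
    forall a, theta a = (fun n => bin_transform (nth_term a) (val n)).
  apply: algMorphism_intro => [a b||a b|c a]; apply/funext => n.
  - exact: bin_transformD.
  - exact: bin_transform_one (valP n).
  - exact: bin_transform_mul (valP n).
  - rewrite /bin_transform /= /GRing.scale /= scaler_sumr.
    by apply: eq_bigr => m _; rewrite term_scale scalerMnr.
have phi_inj : injective phi.
  move=> u v; rewrite !phiE => uv; apply: value_inj => n ln.
  exact: (congr1 (fun f => f (exist _ n ln)) uv).
have theta_inj : injective theta.
  move=> a b; rewrite !thetaE => ab; apply: cdot_eq => n ln.
  exact: (congr1 (fun f => f (exist _ n ln)) ab).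
have theta_surj v : exists a, theta a = v.
  have [a aP] := nth_term_bin_surj v.
  by exists a; rewrite thetaE; apply/funext => n; exact: aP.
have /choice[s sP] := @binomial_series_exists k A l.
have phi_s a : phi (s a) = theta a.
  rewrite phiE thetaE; apply/funext => n.
  exact: binomial_series_value (valP n) (sP a).
have [psi psiE] : exists psi : algMorphism (cdot_seq A l) (poly_mod_binomial A l),
    forall a, psi a = s a.
  (* The chosen sums [s] are so far a bare function; injectivity of [phi] pulls each morphism law
     back from [theta]. *)
  apply: algMorphism_intro => [a b||a b|c a]; apply: phi_inj.
  - by rewrite rmorphD !phi_s rmorphD.
  - by rewrite phi_s !rmorph1.
  - by rewrite rmorphM !phi_s rmorphM.
  - by rewrite alg_morphismZ !phi_s alg_morphismZ.
have phi_psi a : phi (psi a) = theta a by rewrite psiE.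
exists psi; split=> [a|]; first by rewrite psiE.
exists phi; split=> [f n|]; first by rewrite phiE; exact: is_value_at_value (valP n).
split.
  apply: inj_surj_bij => // v; have [a <-] := theta_surj v.
  by exists (psi a).
exists theta; split=> [a n|]; first by rewrite thetaE.
split; first exact: inj_surj_bij.
split=> //; apply: inj_surj_bij => [a b ab|u].
  by apply: theta_inj; rewrite -!phi_psi ab.
(* A preimage of [u] under [psi] is any preimage of [phi u] under [theta]. *)
have [a] := theta_surj (phi u); rewrite -phi_psi => /phi_inj <-.
by exists a.
Qed.
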